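(* Let $X=[0,1]$ or $X=\mathbb{S}^1$, with the metric $|\cdot|$ inherited from the line. Then the map $\mathrm{mdim}_M:C^0(X)\to\mathbb{R}$, $\phi\mapsto\mathrm{mdim}_M(X,\phi,|\cdot|)$, is neither lower semi-continuous nor upper semi-continuous. Furthermore, $\mathrm{mdim}_M:C^0(X)\to\mathbb{R}$ is not lower semi-continuous at any $\phi\in C^0(X)$ with $\mathrm{mdim}_M(X,\phi,|\cdot|)\in(0,1]$, and is not upper semi-continuous at any $\phi\in C^0(X)$ with $\mathrm{mdim}_M(X,\phi,|\cdot|)\in[0,1)$. (This is asserted both for the lower metric mean dimension $\underline{\mathrm{mdim}_M}$ and for the upper metric mean dimension $\overline{\mathrm{mdim}_M}$.)
   Context: The interval $[0,1]$ carries the metric $|x-y|$ and the circle $\mathbb{S}^1=\mathbb{R}/\mathbb{Z}$ the quotient (arc-length) metric. For a compact metric space $(X,d)$, $C^0(X)$ is the set of continuous maps $X\to X$ with the uniform metric $d(\phi,\varphi)=\max_{x\in X}d(\phi(x),\varphi(x))$. For $\phi\in C^0(X)$ and $n\ge1$ let $d_n(x,y)=\max_{0\le j\le n-1}d(\phi^j(x),\phi^j(y))$. A set $A\subset X$ is $(n,\phi,\varepsilon)$-separated if $d_n(x,y)>\varepsilon$ for all distinct $x,y\in A$; $\mathrm{sep}(n,\phi,\varepsilon)$ is the maximal cardinality of such a set, and $\mathrm{sep}(\phi,\varepsilon)=\limsup_{n\to\infty}\frac1n\log \mathrm{sep}(n,\phi,\varepsilon)$. The lower and upper metric mean dimensions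 are $$\underline{\mathrm{mdim}_M}(X,\phi,d)=\liminf_{\varepsilon\to0}\frac{\mathrm{sep}(\phi,\varepsilon)}{|\log\varepsilon|},\qquad \overline{\mathrm{mdim}_M}(X,\phi,d)=\limsup_{\varepsilon\to0}\frac{\mathrm{sep}(\phi,\varepsilon)}{|\log\varepsilon|}.$$ The symbol $\mathrm{mdim}_M$ without underline or overline means that the assertion holds for each of the two. A function $F:Y\to\mathbb{R}\cup\{\infty\}$ on a metric space $Y$ is lower (resp. upper) semi-continuous at $y_0\in Y$ if $\liminf_{y\to y_0}F(y)\ge F(y_0)$ (resp. $\limsup_{y\to y_0}F(y)\le F(y_0)$), and lower (resp. upper) semi-continuous if it is so at every point of $Y$. *)

(* Defs.v *)
From HB Require Import structures.
From mathcomp Require Import all_boot all_order all_algebra.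
From mathcomp Require Import generic_quotient archimedean finmap.
From mathcomp Require Import lra.
From mathcomp Require Import all_classical all_reals all_analysis.

Set Implicit Arguments.
Unset Strict Implicit.
Unset Printing Implicit Defensive.

Import Order.TTheory GRing.Theory Num.Theory.
Import numFieldNormedType.Exports.

Local Open Scope classical_set_scope.
Local Open Scope ring_scope.

HB.mixin Record isCompactSpace T & Topological T := {
  compact_setT : compact [set: T]
}.

#[short(type="compactMetricType")]
HB.structure Definition CompactMetric (R : realType) :=
  { T of Metric R T & isCompactSpace T }.

Lemma compact_mdist_bounded (R : realType) (X : compactMetricType R) :
  exists M : R, forall x y : X, mdist x y <= M.
Proof.
have [[x0]|X0] := pselect (exists x : X, True); last first.
  by exists 0 => x; exfalso; apply: X0; exists x.
move=> _.
have cf : continuous (fun y : X => mdist x0 y : R).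
  move=> x; apply/cvgrPdist_lt => e e0.
  apply/metricType_numDomainType.nbhs_mdistP; exists e => //= y xy.
  have := metric_triangle x0 x y; have := metric_triangle x0 y x.
  rewrite (metric_sym y x) ltr_norml; move: xy => /=.
  move: (mdist x y) (mdist x0 x) (mdist x0 y) => a b c ac cb ab.
  by apply/andP; split; lra.
have /compact_bounded [M [_ HM]] : compact (range (fun y : X => mdist x0 y : R)).
  apply: continuous_compact; last exact: compact_setT.
  exact: continuous_subspaceT.
exists ((M + 1) + (M + 1)) => x y.
have H z : mdist x0 z <= M + 1.
  have := HM (M + 1); rewrite ltrDl ltr01 => /(_ isT (mdist x0 z)) /=.
  by move=> /(_ (ex_intro2 _ _ z I erefl)); apply: le_trans; exact: ler_norm.
by rewrite (le_trans (metric_triangle x x0 y))// lerD// metric_sym.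
Qed.

Lemma lipschitz_image_compact (R : realType) (T : metricType R) (g : R -> T) :
  {in `[0, 1] &, forall x y, mdist (g x) (g y) <= `|x - y|} ->
  (forall t, exists2 x, x \in `[0, 1] & g x = t) -> compact [set: T].
Proof.
move=> gL gS; have -> : [set: T] = g @` `[0, 1].
  apply/esym/seteqP; split => // t _.
  by have [x x01 <-] := gS t; exists x.
apply: continuous_compact; last exact: segment_compact.
apply/subspace_continuousP => x x01.
apply/metricType_numDomainType.cvgrPdist_lt => e e0.
rewrite near_withinE; near=> y => y01.
by rewrite (le_lt_trans (gL _ _ x01 y01))//.
Unshelve. all: by end_near. Qed.

(* [continuousType X X] gets its topologies from local modules only; the alias
   carries the metric of uniform convergence. *)
Definition C0 (R : realType) (X : compactMetricType R) : Type :=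
  continuousType X X.

Section uniform_metric.
Context (R : realType) (X : compactMetricType R).

HB.instance Definition _ := Choice.on (C0 X).

(* By compactness the supremum is a maximum, also in the degenerate case where
   X is empty, as [sup set0 = 0]. *)
Definition unif_dist (f g : C0 X) : R :=
  sup (range (fun x : X => mdist (f x) (g x))).

Let unif_ub (f g : C0 X) x : mdist (f x) (g x) <= unif_dist f g.
Proof.
apply: sup_upper_bound; last by exists x.
split; first by exists (mdist (f x) (g x)), x.
have [M HM] := compact_mdist_bounded X.
by exists M => _ [z _ <-].
Qed.

Let unif_le (f g : C0 X) (M : R) : 0 <= M ->
  (forall x, mdist (f x) (g x) <= M) -> unif_dist f g <= M.
Proof.
move=> M0 H; rewrite /unif_dist.
have [->|/set0P ne] := eqVneq (range (fun x : X => mdist (f x) (g x))) set0.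
  by rewrite sup0.
by apply: ge_sup => // _ [x _ <-].
Qed.

Let unif_ge0 (f g : C0 X) : 0 <= unif_dist f g.
Proof.
have [[x _]|X0] := pselect (exists x : X, True).
  by rewrite (le_trans _ (unif_ub f g x))// mdist_ge0.
rewrite /unif_dist [X in sup X](_ : _ = set0) ?sup0//.
by rewrite -subset0 => r [x]; case: X0; exists x.
Qed.

Let unif_xx (f : C0 X) : unif_dist f f = 0.
Proof.
apply/eqP; rewrite eq_le unif_ge0 andbT unif_le// => x.
by rewrite mdistxx.
Qed.

Let unif_pos (f g : C0 X) : unif_dist f g = 0 -> f = g.
Proof.
move=> fg; apply/continuousEP => x; apply: (@mdist_positivity R).
by apply/eqP; rewrite eq_le mdist_ge0 andbT -fg unif_ub.
Qed.

Let unif_sym (f g : C0 X) : unif_dist f g = unif_dist g f.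
Proof.
rewrite /unif_dist; congr (sup _); apply/seteqP.
by split=> _ [x _ <-]; exists x => //; rewrite metric_sym.
Qed.

Let unif_tri (g f h : C0 X) : unif_dist f h <= unif_dist f g + unif_dist g h.
Proof.
apply: unif_le => [|x]; first by rewrite addr_ge0.
by rewrite (le_trans (metric_triangle _ (g x) _))// lerD.
Qed.

HB.instance Definition _ :=
  isMetric.Build R (C0 X) unif_xx unif_pos unif_sym unif_tri.

End uniform_metric.

Section metric_mean_dimension.
Context (R : realType) (X : compactMetricType R).
Implicit Types (phi : C0 X) (n : nat) (eps : R).

Definition dynamic_dist n phi (x y : X) : R :=
  \big[Num.max/0]_(j < n) mdist (iter j phi x) (iter j phi y).

Definition separated n phi eps (A : set X) : Prop :=
  forall x y, A x -> A y -> x <> y -> eps < dynamic_dist n phi x y.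

Local Open Scope ereal_scope.

Definition sep n phi eps : \bar R :=
  ereal_sup [set ((#|` A|)%fset%:R)%:E
            | A in [set A : {fset X} | separated n phi eps [set` A]]].

Definition sep_rate phi eps : \bar R :=
  limn_esup (fun n => (n%:R^-1)%:E * lne (sep n phi eps)).

Definition lower_mdim phi : \bar R :=
  limf_einf (fun eps : R => sep_rate phi eps * (`|ln eps|^-1)%:E) 0^'+.

Definition upper_mdim phi : \bar R :=
  limf_esup (fun eps : R => sep_rate phi eps * (`|ln eps|^-1)%:E) 0^'+.

End metric_mean_dimension.

Section semicontinuity.
Context (R : realType) (Y : metricType R).
Local Open Scope ereal_scope.

Definition lower_semicontinuous_at (F : Y -> \bar R) (y0 : Y) : Prop :=
  F y0 <= limf_einf F y0^'.

Definition upper_semicontinuous_at (F : Y -> \bar R) (y0 : Y) : Prop :=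
  limf_esup F y0^' <= F y0.

End semicontinuity.

Definition unit_interval (R : realType) : Type := set_type `[0 : R, 1].

Section unit_interval_metric.
Context (R : realType).

HB.instance Definition _ :=
  PseudoMetric.copy (unit_interval R) (set_type `[0 : R, 1]).

Let dist (x y : unit_interval R) : R := `|set_val x - set_val y|.

Let dist_ge0 x y : 0 <= dist x y. Proof. exact: normr_ge0. Qed.

Let dist_pos x y : dist x y = 0 -> x = y.
Proof. by move=> /normr0_eq0/eqP; rewrite subr_eq0 => /eqP/val_inj. Qed.

Let ballEdist x d : ball x d = [set y | dist x y < d].
Proof. by []. Qed.

HB.instance Definition _ :=
  PseudoMetric_isMetric.Build R (unit_interval R) dist_ge0 dist_pos ballEdist.

Let interval_compact : compact [set: unit_interval R].
Proof.
have h0 : (0 : R) \in (`[0, 1]%classic : set R).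
  by rewrite inE /= in_itv /= lexx ler01.
pose g (x : R) : unit_interval R := insubd (exist _ 0 h0 : unit_interval R) x.
have gE x : x \in `[0, 1] -> set_val (g x) = x.
  by move=> x01; rewrite /g set_valE insubdK// inE.
apply: (@lipschitz_image_compact _ _ g).
  by move=> x y x01 y01; rewrite /mdist /= /dist !gE.
move=> t; exists (set_val t); first exact: (set_valP t).
by apply: val_inj; rewrite -set_valE gE//; exact: (set_valP t).
Qed.

HB.instance Definition _ :=
  isCompactSpace.Build (unit_interval R) interval_compact.

End unit_interval_metric.

Section circle.
Context (R : realType).
Local Open Scope quotient_scope.

Definition circle_rel : rel R := fun x y => x - y \is a Num.int.

Lemma circle_rel_equiv : equiv_class_of circle_rel.
Proof.
split=> [x|x y|y x z]; rewrite /circle_rel.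
- by rewrite subrr rpred0.
- by rewrite -rpredN opprB.
- by move=> xy yz; rewrite -(subrKA y) rpredD.
Qed.

Canonical circle_equiv := EquivRelPack circle_rel_equiv.

Definition circle : Type := {eq_quot circle_equiv}.

HB.instance Definition _ := EqQuotient.on circle.
HB.instance Definition _ := Choice.on circle.

Lemma circle_piP (x y : R) : \pi_circle x = \pi_circle y <-> x - y \is a Num.int.
Proof. by split=> [/eqmodP|?]; last exact/eqmodP. Qed.

Definition circle_dist (a b : circle) : R :=
  inf [set `|p.1 - p.2| | p in [set p : R * R
    | \pi_circle p.1 = a /\ \pi_circle p.2 = b]].

Let dset (a b : circle) := [set `|p.1 - p.2| | p in [set p : R * R
    | \pi_circle p.1 = a /\ \pi_circle p.2 = b]].

Let dset_lb a b : lbound (dset a b) 0.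
Proof. by move=> _ [p _ <-]; exact: normr_ge0. Qed.

Let dset_n0 a b : dset a b !=set0.
Proof. by exists `|repr a - repr b|, (repr a, repr b) => //=; rewrite !reprK. Qed.

Let dset_le a b x y : \pi_circle x = a -> \pi_circle y = b ->
  circle_dist a b <= `|x - y|.
Proof.
move=> xa yb; apply: ge_inf; first by exists 0; exact: dset_lb.
by exists (x, y).
Qed.

Let dist_ge0 a b : 0 <= circle_dist a b.
Proof. by apply: lb_le_inf; [exact: dset_n0|exact: dset_lb]. Qed.

Let dist_xx a : circle_dist a a = 0.
Proof.
apply/eqP; rewrite eq_le dist_ge0 andbT.
by rewrite (le_trans (dset_le (reprK a) (reprK a)))// subrr normr0.
Qed.

Let dist_pos a b : circle_dist a b = 0 -> a = b.
Proof.
move=> ab0.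
have [_ [[x y] /= [xa yb] <-]] : exists2 r, dset a b r & r < 2^-1.
  by apply: inf_lt; [exact: dset_n0|rewrite [inf _]ab0 invr_gt0].
have [xy0 _|xy0 xyh] := eqVneq `|x - y| 0.
  by rewrite -xa -yb; congr (\pi _); apply/eqP; rewrite -subr_eq0 -normr_eq0 xy0.
have [_ [[x' y'] /= [xa' yb'] <-]] : exists2 r, dset a b r & r < `|x - y|.
  by apply: inf_lt; [exact: dset_n0|rewrite [inf _]ab0 lt_neqAle eq_sym xy0/=].
move=> lt'.
have : (x - y) - (x' - y') \is a Num.int.
  have /circle_piP h1 : \pi_circle x = \pi_circle x' by rewrite xa xa'.
  have /circle_piP h2 : \pi_circle y = \pi_circle y' by rewrite yb yb'.
  have -> : (x - y) - (x' - y') = (x - x') - (y - y') by lra.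
  exact: rpredB.
move=> /norm_intr_ge1 k1; have : (x - y) - (x' - y') != 0.
  by apply: contraTneq lt' => /subr0_eq ->; rewrite ltxx.
by move=> /k1 ?; exfalso; have := ler_normB (x - y) (x' - y'); lra.
Qed.

Let dist_sym a b : circle_dist a b = circle_dist b a.
Proof.
rewrite /circle_dist; congr inf; apply/seteqP; split => _ [[x y] /= [xa yb] <-].
  by exists (y, x) => //=; rewrite distrC.
by exists (y, x) => //=; rewrite distrC.
Qed.

Let dist_tri b a c : circle_dist a c <= circle_dist a b + circle_dist b c.
Proof.
apply/ler_addgt0Pr => e e0.
have e20 : 0 < e / 2 by rewrite divr_gt0.
have inf_ex u v : exists2 r, dset u v r & r < circle_dist u v + e / 2.
  by apply: inf_lt; [exact: dset_n0|rewrite ltrDl].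
have [_ [[x y] /= [xa yb] <-] h1] := inf_ex a b.
have [_ [[y' z] /= [yb' zc] <-] h2] := inf_ex b c.
have zc' : \pi_circle (z - (y' - y)) = c.
  rewrite -zc; apply/circle_piP; rewrite addrAC subrr sub0r rpredN.
  by apply/circle_piP; rewrite yb yb'.
rewrite (le_trans (dset_le xa zc'))//.
have -> : x - (z - (y' - y)) = (x - y) + (y' - z).
  by lra.
rewrite (le_trans (ler_normD _ _))// [leRHS](_ : _ =
  (circle_dist a b + e / 2) + (circle_dist b c + e / 2)); last first.
  by rewrite addrACA -splitr.
by rewrite lerD// ltW.
Qed.

HB.instance Definition _ :=
  isMetric.Build R circle dist_xx dist_pos dist_sym dist_tri.

Let circle_compact : compact [set: circle].
Proof.
apply: (@lipschitz_image_compact _ _ (fun x => \pi_circle x)).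
  by move=> x y _ _; exact: dset_le.
move=> t; exists (repr t - (Num.floor (repr t))%:~R).
  have := floor_itv (repr t); rewrite intrD => /andP[h1 h2].
  by rewrite in_itv /=; apply/andP; split; lra.
rewrite -[RHS]reprK; apply/circle_piP.
by rewrite addrAC subrr sub0r rpredN intr_int.
Qed.

HB.instance Definition _ := isCompactSpace.Build circle circle_compact.

End circle.

(* Main.v *)
Require Import Defs.
From HB Require Import structures.
From mathcomp Require Import all_boot all_order all_algebra.
From mathcomp Require Import generic_quotient archimedean finmap ring lra.
From mathcomp Require Import all_classical all_reals all_analysis.

Set Implicit Arguments.
Unset Strict Implicit.
Unset Printing Implicit Defensive.

Import Order.TTheory GRing.Theory Num.Theory.
Import numFieldNormedType.Exports.

Local Open Scope classical_set_scope.
Local Open Scope ring_scope.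

(** Maps with metric mean dimension [0] and maps with metric mean dimension
    arbitrarily close to [1] are both dense in [C0 X].  Given [phi], take a fine
    grid and a lift of [phi] at the grid points, rounded to the grid.
    Interpolating piecewise affinely gives a Lipschitz map near [phi], whose
    entropy at every scale is bounded by the logarithm of the Lipschitz constant,
    so its metric mean dimension vanishes.  If instead, on the left half of each
    cell, one inserts a scaled copy of [t |-> tent t * sin^2 (pi * t^-p)], the left
    halves are mapped into one another, and at scale about [2^-(k (p + 1))] the map
    contains a full shift on [2^(k p)] symbols; hence both metric mean dimensions
    are at least [p / (p + 1)]. *)

(** * Bounds on limits superior and inferior along a filter *)

Section limf.
Local Open Scope ereal_scope.
Context (T : choiceType) (X : filteredType T) (R : realType).
Implicit Types (f : X -> \bar R) (F : set_system X).

Lemma limf_esup_le f F (V : set X) (l : \bar R) :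
  F V -> (forall x, V x -> f x <= l) -> limf_esup f F <= l.
Proof.
move=> FV fl; rewrite limf_esupE; apply: (@le_trans _ _ (ereal_sup (f @` V))).
  by apply: ereal_inf_lbound; exists V.
by apply: ge_ereal_sup => _ [x Vx <-]; exact: fl.
Qed.

Lemma limf_esup_ge f F (l : \bar R) :
  (forall V, F V -> exists2 x, V x & l <= f x) -> l <= limf_esup f F.
Proof.
move=> H; rewrite limf_esupE; apply: le_ereal_inf_tmp => _ [V FV <-].
have [x Vx lx] := H _ FV.
by apply: le_trans lx _; apply: ereal_sup_ubound; exists x.
Qed.

Lemma limf_einf_ge f F (V : set X) (l : \bar R) :
  F V -> (forall x, V x -> l <= f x) -> l <= limf_einf f F.
Proof.
move=> FV fl; rewrite limf_einfE.
apply: (@le_trans _ _ (ereal_inf (f @` V))); last first.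
  by apply: ereal_sup_ubound; exists V.
by apply: le_ereal_inf_tmp => _ [x Vx <-]; exact: fl.
Qed.

Lemma limf_einf_le f F (l : \bar R) :
  (forall V, F V -> exists2 x, V x & f x <= l) -> limf_einf f F <= l.
Proof.
move=> H; rewrite limf_einfE; apply: ge_ereal_sup => _ [V FV <-].
have [x Vx xl] := H _ FV.
by apply: le_trans _ xl; apply: ereal_inf_lbound; exists x.
Qed.

Lemma limf_einf_le_esup f F : ProperFilter F -> limf_einf f F <= limf_esup f F.
Proof.
move=> FF; rewrite limf_esupE; apply: le_ereal_inf_tmp => _ [V FV <-].
apply: limf_einf_le => W FW.
have [x [Vx Wx]] := filter_ex (filterI FV FW).
by exists x => //; apply: ereal_sup_ubound; exists x.
Qed.

End limf.

(** * Counting separated points: lower bounds, and the Lipschitz case *)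

Section separated_sets.
Context (R : realType) (X : compactMetricType R).
Implicit Types (phi : C0 X) (n : nat) (eps : R).

Lemma lower_le_upper_mdim phi : (lower_mdim phi <= upper_mdim phi)%E.
Proof. exact: limf_einf_le_esup. Qed.

(** Since [eps] is nonnegative, the hypothesis forces [g] to be injective, so its image is a
    separated set with as many points as [I]. *)
Lemma sep_ge_card n phi eps (I : finType) (g : I -> X) : 0 <= eps ->
  (forall i j, i != j -> exists2 k, (k < n)%N &
     eps < mdist (iter k phi (g i)) (iter k phi (g j))) ->
  ((#|I|%:R)%:E <= sep n phi eps)%E.
Proof.
move=> eps0 H; apply: ereal_sup_ubound => /=.
have ginj : injective g.
  move=> i j ij; apply/eqP/negP => /negP/H[k _].
  by rewrite ij mdistxx => /(le_lt_trans eps0); rewrite ltxx.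
exists [fset g i | i in I]%fset; last by rewrite card_imfset//= cardE.
move=> x y /= /imfsetP[i _ ->] /imfsetP[j _ ->] gij.
have [|k kn epsk] := H i j; first by apply/eqP => ij; apply: gij; rewrite ij.
apply: lt_le_trans epsk _.
exact: (le_bigmax _ (fun l : 'I_n => mdist (iter l phi (g i)) (iter l phi (g j)))
  (Ordinal kn)).
Qed.

Lemma sep_rate_ge phi eps (s : nat) : (0 < s)%N ->
  (forall n, ((s ^ n)%:R%:E <= sep n phi eps)%E) ->
  ((ln s%:R)%:E <= sep_rate phi eps)%E.
Proof.
move=> s0 H; apply: limf_esup_ge => V [N _ NV].
(* The successor avoids time 0, where the factor [n%:R^-1] is 0. *)
exists N.+1; first by apply: NV => /=.
have sN : (0 : R) < (s ^ N.+1)%:R by rewrite ltr0n expn_gt0 s0.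
apply: (@le_trans _ _ ((N.+1%:R^-1)%:E * lne (s ^ N.+1)%:R%:E)%E).
  rewrite lne_EFin// -EFinM lee_fin natrX lnXn ?ltr0n// -(mulr_natl (ln _)) mulKf//.
rewrite lee_pmul2l// ?lte_fin ?invr_gt0 ?ltr0n//.
have h := H N.+1; rewrite lee_lne// in_itv/= leey andbT ?lee_fin ?ltW//.
by apply: lt_le_trans h.
Qed.

Lemma sep_le n phi eps (M : R) :
  (forall A : {fset X}, Defs.separated n phi eps [set` A] -> #|` A|%:R <= M) ->
  (sep n phi eps <= M%:E)%E.
Proof. by move=> H; apply: ge_ereal_sup => _ [A /H ? <-]; rewrite lee_fin. Qed.

(** Pigeonhole: [g] below sends a point to the index of the interval of length [eta] that contains
    its coordinate [s x]. Two points with the same index are at distance at most [eta], and the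
    indices run up to the integer part of [eta^-1]. *)
Lemma card_separated (s : X -> R) (eta : R) (A : {fset X}) : 0 < eta ->
  (forall x, 0 <= s x <= 1) -> (forall x y, mdist x y <= `|s x - s y|) ->
  (forall x y, x \in A -> y \in A -> x != y -> eta < mdist x y) ->
  #|` A|%:R <= eta^-1 + 1.
Proof.
move=> eta0 s01 ds Aeta.
pose g x := Num.truncn (s x / eta).
have gP x : (g x)%:R <= s x / eta < (g x).+1%:R.
  by apply: truncn_itv; rewrite divr_ge0 ?(ltW eta0)//; have /andP[] := s01 x.
have ginj : {in A &, injective g}.
  move=> x y xA yA gxy; apply/eqP/negP => /negP/(Aeta _ _ xA yA) xy.
  have := lt_le_trans xy (ds x y); apply/negP; rewrite -leNgt.
  have := gP x; rewrite gxy => /andP[x1 x2]; have /andP[y1 y2] := gP y.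
  rewrite -[leRHS]mul1r -ler_pdivrMr// -[eta^-1]gtr0_norm ?invr_gt0// -normrM.
  rewrite mulrBl; move: x1 x2 y1 y2; rewrite -natr1; set a := s x / eta.
  by set b := s y / eta => *; rewrite ler_norml; apply/andP; split; lra.
have t1 : 0 <= eta^-1 by rewrite invr_ge0 ltW.
apply: (@le_trans _ _ (Num.truncn eta^-1).+1%:R); last first.
  by rewrite -natr1 lerD2r; have /andP[] := truncn_itv t1.
rewrite ler_nat -[X in (_ <= X)%N](size_iota 0) cardfE cardE -(size_map (g \o val)).
apply: uniq_leq_size.
  rewrite map_inj_uniq ?enum_uniq// => x y /= gxy; apply: val_inj.
  exact: ginj (valP x) (valP y) gxy.
move=> _ /mapP[x _ ->]; rewrite mem_iota/= add0n ltnS /g.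
apply: le_truncn; rewrite ler_pdivrMr// mulVf ?gt_eqF//.
by have /andP[] := s01 (val x).
Qed.

Lemma lipschitz_iter phi (L : R) k (x y : X) : 0 <= L ->
  (forall x y, mdist (phi x) (phi y) <= L * mdist x y) ->
  mdist (iter k phi x) (iter k phi y) <= L ^+ k * mdist x y.
Proof.
move=> L0 phiL; elim: k => [|k IH]; first by rewrite expr0 mul1r.
by rewrite !iterS (le_trans (phiL _ _))// exprS -mulrA ler_wpM2l.
Qed.

(** An [(n, phi, eps)]-separated set is [eps / L ^+ n]-separated for the metric itself, hence has at
    most [L ^+ n * K] points with [K = eps^-1 + 1]. The term [1] absorbs [ln K / n] for large [n];
    what matters is that the bound does not depend on [eps]. *)
Lemma lipschitz_sep_rate phi (L : R) (s : X -> R) eps : 1 <= L -> 0 < eps ->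
  (forall x, 0 <= s x <= 1) -> (forall x y, mdist x y <= `|s x - s y|) ->
  (forall x y, mdist (phi x) (phi y) <= L * mdist x y) ->
  (sep_rate phi eps <= (ln L + 1)%:E)%E.
Proof.
move=> L1 eps0 s01 ds phiL.
have L0 : 0 < L by apply: lt_le_trans L1.
pose K := eps^-1 + 1.
have K0 : 0 < K by rewrite addr_gt0 ?invr_gt0.
have sepK n : (sep n phi eps <= (L ^+ n * K)%:E)%E.
  apply: sep_le => A Asep.
  have Ln0 : 0 < L ^+ n by rewrite exprn_gt0.
  have e0 : 0 < eps / L ^+ n by rewrite divr_gt0.
  apply: (@le_trans _ _ ((eps / L ^+ n)^-1 + 1)).
    apply: (card_separated e0 s01 ds) => x y xA yA xy.
    rewrite ltr_pdivrMr// mulrC; apply: lt_le_trans (Asep x y xA yA (elimN eqP xy)) _.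
    apply: bigmax_le => [|k _]; first by rewrite mulr_ge0 ?mdist_ge0// ltW.
    apply: le_trans (lipschitz_iter _ _ _ (ltW L0) phiL) _.
    by rewrite ler_wpM2r ?mdist_ge0// ler_weXn2l// ltnW.
  rewrite invf_div mulrDr mulr1 lerD2l; exact: exprn_ege1.
pose N := (Num.truncn (ln K)).+1.
have lnKN : ln K <= N%:R by apply/ltW; exact: truncnS_gt.
apply: (limf_esup_le (V := [set n | (N <= n)%N])); first by exists N.
move=> n /= Nn.
have n0 : (0 : R) < n%:R by rewrite ltr0n (leq_trans _ Nn).
apply: (@le_trans _ _ ((n%:R^-1)%:E * lne (L ^+ n * K)%:E)%E).
  rewrite lee_pmul2l// ?lte_fin ?invr_gt0//.
  (* Here [lne] is [-oo], so nothing is to be shown. *)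
  have [s0|s0] := leP (sep n phi eps) 0%E; first by rewrite le0_lneNy ?leNye.
  rewrite lee_lne// in_itv/= leey andbT ?(ltW s0)//.
  by rewrite lee_fin mulr_ge0 ?exprn_ge0// ltW.
rewrite lne_EFin ?mulr_gt0 ?exprn_gt0// -EFinM lee_fin lnM ?posrE ?exprn_gt0//.
rewrite lnXn// -(mulr_natl (ln _)) mulrDr mulKf ?gt_eqF// lerD2l.
by rewrite mulrC ler_pdivrMr// mul1r (le_trans lnKN)// ler_nat.
Qed.

Lemma lipschitz_upper_mdim phi (L : R) (s : X -> R) : 1 <= L ->
  (forall x, 0 <= s x <= 1) -> (forall x y, mdist x y <= `|s x - s y|) ->
  (forall x y, mdist (phi x) (phi y) <= L * mdist x y) ->
  (upper_mdim phi <= 0)%E.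
Proof.
move=> L1 s01 ds phiL; apply/lee_addgt0Pr => e e0; rewrite add0e.
have h0 : 0 < ln L + 1 by rewrite ltr_wpDl ?ln_ge0.
(* Below this threshold [|ln eps|] exceeds [(ln L + 1) / e], so the quotient is at most [e]. *)
pose d := expR (- ((ln L + 1) / e)).
have d1 : d < 1 by rewrite expR_lt1 oppr_lt0 divr_gt0.
apply: (limf_esup_le (V := [set x | 0 < x < d])).
  by near=> x; rewrite /=; apply/andP; split=> //; near: x; apply: nbhs_right_lt; exact: expR_gt0.
move=> x /= /andP[x0 xd].
have lnx : (ln L + 1) / e < - ln x.
  by rewrite ltrNr -[ltRHS]expRK ltr_ln ?posrE ?expR_gt0.
have q0 : 0 < (ln L + 1) / e by rewrite divr_gt0.
have nx : 0 < `|ln x| by rewrite normr_gt0; apply/eqP => z; move: lnx; rewrite z; lra.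
apply: (@le_trans _ _ ((ln L + 1)%:E * (`|ln x|^-1)%:E)%E).
  rewrite lee_pmul2r ?lte_fin ?invr_gt0//.
  exact: lipschitz_sep_rate s01 ds phiL.
rewrite -EFinM lee_fin ler_pdivrMr// mulrC -ler_pdivrMr//.
by rewrite (le_trans (ltW lnx))// -normrN ler_norm.
Unshelve. all: by end_near. Qed.

End separated_sets.

(** * The oscillating map and its full shifts *)

Section wild_map.
Context {R : realType}.
Implicit Types (t u x y : R) (p k m n : nat).

Definition tent t : R := Num.max 0 (Num.min (2 * t) (2 - 2 * t)).

Lemma tent_ge0 t : 0 <= tent t.
Proof. by rewrite /tent le_max lexx. Qed.

Lemma tent_le1 t : tent t <= 1.
Proof.
by rewrite /tent ge_max ler01/= ge_min; have [] := leP (2 * t) 1 => //=; lra.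
Qed.

Lemma tent_out t : t <= 0 \/ 1 <= t -> tent t = 0.
Proof.
move=> H; apply/eqP; rewrite eq_le tent_ge0 andbT /tent ge_max lexx/= ge_min.
by case: H => ?; apply/orP; [left|right]; lra.
Qed.

Lemma tentE t : 0 <= t <= 2^-1 -> tent t = 2 * t.
Proof.
by move=> /andP[t0 t1]; rewrite /tent min_l ?max_r//; lra.
Qed.

Lemma continuous_tent : continuous tent.
Proof.
move=> x.
have c1 : {for x, continuous ( *%R 2 : R -> R^o)} by exact: mulrl_continuous.
have c2 : {for x, continuous ((fun t => 2 - 2 * t) : R -> R^o)}.
  by apply: cvgB; [exact: cvg_cst|exact: mulrl_continuous].
have c0 : {for x, continuous (cst 0 : R -> R^o)} by exact: cst_continuous.
exact: continuous_max c0 (continuous_min c1 c2).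
Qed.

Definition wild p t : R := tent t * sin (pi * t^-1 ^+ p) ^+ 2.

Lemma wild_ge0 p t : 0 <= wild p t.
Proof. by rewrite mulr_ge0 ?tent_ge0 ?sqr_ge0. Qed.

Lemma sin2_le1 x : sin x ^+ 2 <= 1.
Proof. by rewrite -(cos2Dsin2 x) lerDr sqr_ge0. Qed.

Lemma wild_le_tent p t : wild p t <= tent t.
Proof. by rewrite ler_piMr ?tent_ge0 ?sin2_le1. Qed.

Lemma wild_le1 p t : wild p t <= 1.
Proof. exact: le_trans (wild_le_tent p t) (tent_le1 t). Qed.

Lemma wild_out p t : t <= 0 \/ 1 <= t -> wild p t = 0.
Proof. by move=> /tent_out H; rewrite /wild H mul0r. Qed.

(** Only the points [x <= 0] need an argument: there the oscillating factor is of no help, and the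
    map is squeezed between 0 and [tent]. *)
Lemma continuous_wild p : continuous (wild p).
Proof.
move=> x; have [x0|x0] := leP x 0.
  have tx : tent x = 0 by apply: tent_out; left.
  have wx : wild p x = 0 by apply: wild_out; left.
  rewrite /continuous_at wx.
  apply: (@squeeze_cvgr _ _ _ _ (cst 0) tent).
  - by apply: nearW => t; rewrite wild_ge0 wild_le_tent.
  - exact: cvg_cst.
  - by rewrite -[X in _ --> X]tx; exact: continuous_tent.
apply: cvgM; first exact: continuous_tent.
apply: (@continuous_comp _ _ _ (fun t => sin (pi * t^-1 ^+ p)) (fun u => u ^+ 2));
  last exact: exprn_continuous.
apply: (@continuous_comp _ _ _ (fun t => pi * t^-1 ^+ p) sin);
  last exact: continuous_sin.
apply: (@continuous_comp _ _ _ (fun t => t^-1 ^+ p) ( *%R pi));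
  last exact: mulrl_continuous.
apply: (@continuous_comp _ _ _ (fun t => t^-1) (fun u => u ^+ p));
  last exact: exprn_continuous.
by apply: inv_continuous; rewrite gt_eqF.
Qed.

Lemma sin_pi_nat m : sin (pi * m%:R) = 0 :> R.
Proof.
elim: m => [|m IH]; first by rewrite mulr0 sin0.
by rewrite -natr1 mulrDr mulr1 sinDpi IH oppr0.
Qed.

Lemma sin2_pi_half m : sin (pi * (m%:R + 2^-1)) ^+ 2 = 1 :> R.
Proof.
rewrite mulrDr sinDpihalf; have := cos2Dsin2 (pi * m%:R : R).
by rewrite sin_pi_nat expr0n/= addr0.
Qed.

Lemma root_ex p x : (0 < p)%N -> 0 < x -> exists2 u : R, 0 < u & u ^+ p = x.
Proof.
move=> p0 x0; exists (x `^ p%:R^-1); first exact: powR_gt0.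
rewrite -powR_mulrn ?powR_ge0// -powRrM mulVf ?pnatr_eq0 -?lt0n//.
by rewrite powRr1// ltW.
Qed.

Lemma root_itv p x (U : R) : (0 < p)%N -> 0 < U -> U ^+ p <= x <= (2 * U) ^+ p ->
  exists2 t, (2 * U)^-1 <= t <= U^-1 & t^-1 ^+ p = x.
Proof.
move=> p0 U0 /andP[x1 x2].
have [|u u0 ux] := @root_ex p x p0; first by apply: lt_le_trans x1; rewrite exprn_gt0.
exists u^-1; last by rewrite invrK.
rewrite !lef_pV2 ?posrE ?mulr_gt0//.
have XE (a b : R) : 0 < a -> 0 < b -> (a <= b) = (a ^+ p <= b ^+ p).
  by move=> a0 b0; rewrite ler_pXn2r// nnegrE ltW.
by rewrite (XE u) ?mulr_gt0// (XE U)// ux x1 x2.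
Qed.

(* On [m, m + 1/2] the phase [t^-p] carries the sine from a zero to a peak,
   where the tent has height at least the right end of the interval. *)
Lemma wild_cover p m (U : R) y : (0 < p)%N -> 2 <= U ->
  U ^+ p <= m%:R -> m%:R + 2^-1 <= (2 * U) ^+ p ->
  (2 * U)^-1 <= y <= U^-1 ->
  exists t, [/\ (2 * U)^-1 <= t <= U^-1, m%:R <= t^-1 ^+ p <= m%:R + 2^-1
    & wild p t = y].
Proof.
move=> p0 U2 Um mU /andP[y1 y2].
have U0 : 0 < U by lra.
have [|t0 /andP[t01 t02] t0m] := @root_itv p m%:R U p0 U0.
  by apply/andP; split => //; lra.
have [|t1 /andP[t11 t12] t1m] := @root_itv p (m%:R + 2^-1) U p0 U0.
  by apply/andP; split => //; lra.
have U20 : 0 < (2 * U)^-1 by rewrite invr_gt0 mulr_gt0.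
have t00 : 0 < t0 by lra.
have t10 : 0 < t1 by lra.
have Uh : U^-1 <= 2^-1 by rewrite lef_pV2 ?posrE.
have t10le : t1 <= t0.
  rewrite -lef_pV2 ?posrE// -(@ler_pXn2r _ p) ?nnegrE ?invr_ge0 ?(ltW t00) ?(ltW t10)//.
  by rewrite t0m t1m; lra.
have w0 : wild p t0 = 0 by rewrite /wild t0m sin_pi_nat expr0n/= mulr0.
have w1 : U^-1 <= wild p t1.
  rewrite /wild t1m sin2_pi_half mulr1 tentE ?(ltW t10)/=; last by lra.
  by rewrite -(ler_pM2l (ltr0Sn _ 1)) in t11; move: t11; rewrite invfM mulrA divff// mul1r.
have [||t] := @IVT _ (wild p) t1 t0 y t10le.
- by apply: continuous_subspaceT; exact: continuous_wild.
- by rewrite w0 ge_min le_max; apply/andP; split; apply/orP; [right|left]; lra.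
rewrite in_itv/= => /andP[tt1 tt0] <-; exists t; split => //.
  by apply/andP; split; lra.
have t_0 : 0 < t by lra.
rewrite -t1m -t0m !ler_pXn2r ?nnegrE ?invr_ge0 ?(ltW t00) ?(ltW t10) ?(ltW t_0)//.
by rewrite !lef_pV2 ?posrE// tt1 tt0.
Qed.

Lemma ler_dist_expr p x y (U : R) : 0 <= x <= U -> 0 <= y <= U ->
  `|x ^+ p - y ^+ p| <= p%:R * U ^+ p.-1 * `|x - y|.
Proof.
move=> /andP[x0 xU] /andP[y0 yU].
rewrite subrXX normrM mulrC ler_wpM2r//.
rewrite (le_trans (ler_norm_sum _ _ _))//.
rewrite -[X in X%:R * _](card_ord p) mulr_natl -sumr_const ler_sum// => i _.
rewrite ger0_norm ?mulr_ge0 ?exprn_ge0//.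
have -> : U ^+ p.-1 = U ^+ (p.-1 - i) * U ^+ i.
  by rewrite -exprD subnK//; have := ltn_ord i; case: (p) (i) => [[]//|q j]; rewrite ltnS.
by apply: ler_pM; rewrite ?exprn_ge0// lerXn2r// nnegrE (le_trans x0).
Qed.

(** Half the reciprocal of [p * (2 * U) ^ (p + 1)], a Lipschitz constant of [t^-p] on
    [[1 / (2 U), 1 / U]]: phases at least 1/2 apart come from points at least [gap] apart. *)
Definition gap p (U : R) : R := (2 * p%:R * (2 * U) ^+ p.+1)^-1.

Lemma phase_gap p (U : R) t u : (0 < p)%N -> 0 < U ->
  (2 * U)^-1 <= t <= U^-1 -> (2 * U)^-1 <= u <= U^-1 ->
  2^-1 <= `|t^-1 ^+ p - u^-1 ^+ p| -> gap p U <= `|t - u|.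
Proof.
move=> p0 U0 /andP[t1 t2] /andP[u1 u2] tu.
have V0 : 0 < 2 * U by rewrite mulr_gt0.
have V1 : 0 < (2 * U)^-1 by rewrite invr_gt0.
have t0 : 0 < t by exact: lt_le_trans t1.
have u0 : 0 < u by exact: lt_le_trans u1.
have tV : t^-1 <= 2 * U by rewrite -[leRHS]invrK lef_pV2 ?posrE.
have uV : u^-1 <= 2 * U by rewrite -[leRHS]invrK lef_pV2 ?posrE.
have tV0 : 0 <= t^-1 by rewrite invr_ge0 ltW.
have uV0 : 0 <= u^-1 by rewrite invr_ge0 ltW.
have inv : `|t^-1 - u^-1| <= (2 * U) ^+ 2 * `|t - u|.
  have -> : t^-1 - u^-1 = t^-1 * u^-1 * (u - t) by field; rewrite !gt_eqF.
  rewrite normrM (distrC u) ler_wpM2r// ger0_norm ?mulr_ge0// expr2.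
  by rewrite ler_pM.
rewrite /gap -[leLHS]mul1r ler_pdivrMr; last first.
  by rewrite mulr_gt0 ?exprn_gt0// mulr_gt0// ltr0n.
have := le_trans tu (@ler_dist_expr p t^-1 u^-1 (2 * U) _ _).
rewrite tV0 tV uV0 uV => /(_ isT isT) tu'.
have q0 : 0 <= p%:R * (2 * U) ^+ p.-1 by rewrite mulr_ge0// exprn_ge0// ltW.
have := le_trans tu' (ler_wpM2l q0 inv).
rewrite [X in _ <= X](_ : _ = p%:R * (2 * U) ^+ p.+1 * `|t - u|); last first.
  by rewrite -(prednK p0) /= !exprSr; ring.
by move=> ?; lra.
Qed.

(** The point is built backwards: a point [y] realizing the shifted itinerary lies in
    [[1 / (2 U), 1 / U]], and by [wild_cover] it has a preimage in the same interval whose phase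
    lies in the lap starting at [s + a 0]. All [s] laps fit, because [s + a 0 + 1 <= 2 s <= 2 ^ p *
    s = (2 U) ^ p]. *)
Lemma wild_itinerary p (s n : nat) (U : R) (a : nat -> nat) : (0 < p)%N ->
  2 <= U -> s%:R = U ^+ p -> (forall j, (a j < s)%N) ->
  exists2 t, (2 * U)^-1 <= t <= U^-1 & forall j, (j < n)%N ->
    (2 * U)^-1 <= iter j (wild p) t <= U^-1 /\
    (s + a j)%:R <= (iter j (wild p) t)^-1 ^+ p <= (s + a j)%:R + 2^-1.
Proof.
move=> p0 U2 sU; elim: n a => [|n IH] a a_s.
  exists U^-1 => //; rewrite lexx andbT lef_pV2 ?posrE; lra.
have [y yU yP] := IH (fun j => a j.+1) (fun j => a_s j.+1).
have [||t [tU tm ty]] := @wild_cover p (s + a 0%N) U y p0 U2 _ _ yU.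
- by rewrite -sU ler_nat leq_addr.
- have h : (s + a 0%N).+1%:R <= (2 * U) ^+ p.
    rewrite exprMn -sU -natrX -natrM ler_nat -addnS (@leq_trans (2 * s)%N)//.
      by rewrite mul2n -addnn leq_add2l.
    by rewrite leq_mul2r -{1}(expn1 2) leq_exp2l ?p0 ?orbT.
  by rewrite -natr1 in h; lra.
exists t => // -[_|j]; first by split.
by rewrite iterSr ty; exact: yP.
Qed.

(** Distinct words differ at some time [j]. At that time the phases lie in laps [[m, m + 1/2]] with
    distinct integers [m], hence at least 1/2 apart, and [phase_gap] applies. *)
Lemma wild_separated p (s n : nat) (U : R) : (0 < p)%N -> 2 <= U ->
  s%:R = U ^+ p ->
  exists T : {ffun 'I_n -> 'I_s} -> R, (forall v, 0 <= T v <= 1) /\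
    forall v v', v != v' -> exists2 j, (j < n)%N &
      gap p U <= `|iter j (wild p) (T v) - iter j (wild p) (T v')|.
Proof.
move=> p0 U2 sU; have U0 : 0 < U by lra.
have s0 : (0 < s)%N by rewrite -(ltr0n R) sU exprn_gt0.
(* The finite word is padded with the symbol 0 to an infinite sequence. *)
pose a (v : {ffun 'I_n -> 'I_s}) j : nat :=
  if insub j is Some i then v i else Ordinal s0.
have a_s v j : (a v j < s)%N by rewrite /a; case: insubP => /=.
have /choice[T TP] : forall v, exists t, (2 * U)^-1 <= t <= U^-1 /\
    forall j, (j < n)%N ->
    (2 * U)^-1 <= iter j (wild p) t <= U^-1 /\
    (s + a v j)%:R <= (iter j (wild p) t)^-1 ^+ p <= (s + a v j)%:R + 2^-1.
  by move=> v; have [t ? ?] := @wild_itinerary p s n U (a v) p0 U2 sU (a_s v); exists t.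
exists T; split=> [v|v v' vv'].
  have [/andP[t1 t2] _] := TP v.
  have : 0 < (2 * U)^-1 by rewrite invr_gt0 mulr_gt0.
  have : U^-1 <= 2^-1 by rewrite lef_pV2 ?posrE.
  by move=> ? ?; apply/andP; split; lra.
have /existsP[j vj] : [exists j, v j != v' j].
  rewrite -negb_forall; apply: contra vv' => /forallP H.
  by apply/eqP/ffunP => j; exact/eqP.
exists j => //.
have [_ /(_ j (ltn_ord j))[Jv]] := TP v; have [_ /(_ j (ltn_ord j))[Jv']] := TP v'.
move=> /andP[b1 b2] /andP[c1 c2]; apply: phase_gap => //.
have aj w : a w j = w j by rewrite /a valK.
move: b1 b2 c1 c2; rewrite !aj.
have : (v j < v' j)%N || (v' j < v j)%N by rewrite -neq_ltn.
have lt1 (b c : nat) : (b < c)%N -> (s + b)%:R + 1 <= (s + c)%:R :> R.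
  by move=> bc; rewrite natr1 ler_nat -addnS leq_add2l.
case/orP => /lt1 h b1 b2 c1 c2.
  by rewrite distrC (le_trans _ (ler_norm _))//; lra.
by rewrite (le_trans _ (ler_norm _))//; lra.
Qed.

End wild_map.

(** * Uniform continuity on compact sets *)

Lemma compact_unif_continuous (R : realType) (T U : pseudoMetricType R)
    (K : set T) (f : T -> U) : compact K -> (forall x, K x -> {for x, continuous f}) ->
  forall e : R, 0 < e -> exists2 d : R, 0 < d &
    forall x y, K x -> ball x d y -> ball (f x) e (f y).
Proof.
move=> /compact_near_coveringP cK cf e e0.
have e20 : 0 < e / 2 by rewrite divr_gt0.
(* The near-covering form of compactness yields one [d] for all of [K]. Around each point, half of
   the radius [r] is kept in reserve for the step from [x'] to [y]. *)
have : \forall d \near 0^'+, K `<=` [set x | forall y, ball x d y -> ball (f x) e (f y)].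
  apply: cK => x Kx /=.
  have /nbhs_ballP[r /= r0 rP] : nbhs x (f @^-1` (ball (f x) (e / 2))).
    by apply: cf => //; exact: nbhsx_ballx.
  have r20 : 0 < r / 2 by rewrite divr_gt0.
  exists (ball x (r / 2), [set d | d <= r / 2]) => /=.
    by split; [exact: nbhsx_ballx|exact: nbhs_right_le].
  move=> [x' d] /= [xx' dr] y x'y.
  have fx' : ball (f x) (e / 2) (f x').
    by apply: rP; apply: le_ball xx'; rewrite ler_pdivrMr// ler_pMr// ler1n.
  have fy : ball (f x) (e / 2) (f y).
    apply: rP; rewrite (splitr r); apply: ball_triangle xx' _.
    exact: le_ball x'y.
  by rewrite (splitr e); apply: ball_triangle (ball_sym fx') fy.
move=> H; have [d [/= d0 dP]] := filter_ex (filterI (nbhs_right_gt 0) H).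
by exists d => // x y Kx; exact: dP.
Qed.

(** * Spaces covered by the line *)

Section line_cover.
Context (R : realType) (X : compactMetricType R).

(** For the circle every integer is a period, for the interval only 0. A hypothesis of the form
    [period q 1 -> ...] is therefore a closing condition that binds only on the circle. *)
Definition period (q : R -> X) (m : int) : Prop := forall x, q (x + m%:~R) = q x.

(* Both the interval (with [q] the retraction of the line) and the circle
   (with [q] the quotient map) are of this form. *)
Record line_cover (q : R -> X) : Prop := LineCover {
  cover_lip : forall x y, mdist (q x) (q y) <= `|x - y| ;
  cover_surj : forall a : X, exists2 t, 0 <= t <= 1 & q t = a ;
  cover_lift : forall t u e, 0 <= t <= 1 -> 0 <= u <= 1 -> mdist (q t) (q u) < e ->
    exists2 m : int, period q m & `|u - t - m%:~R| < e }.

Lemma period0 q : period q 0.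
Proof. by move=> x; rewrite addr0. Qed.

Lemma periodD q m m' : period q m -> period q m' -> period q (m + m').
Proof. by move=> qm qm' x; rewrite intrD addrA qm' qm. Qed.

Lemma periodN q m : period q m -> period q (- m).
Proof. by move=> qm x; rewrite -[LHS]qm intrN subrK. Qed.

Lemma period_sum q (m : nat -> int) n :
  (forall i, period q (m i)) -> period q (\sum_(i < n) m i).
Proof.
move=> qm; elim/big_ind: _ => // [|a b]; [exact: period0|exact: periodD].
Qed.

Context (q : R -> X) (hq : line_cover q).

(** A shorter distance would be realized after translation by a period [m]. A nonzero [m] moves
    [u - t] to absolute value at least [1 - 1/2], so nothing is gained. *)
Lemma cover_isometry (t u : R) : 0 <= t <= 1 -> 0 <= u <= 1 -> `|t - u| <= 2^-1 ->
  `|t - u| <= mdist (q t) (q u).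
Proof.
move=> t01 u01 tu; rewrite leNgt; apply/negP => /(cover_lift hq t01 u01)[m _].
have [->|m0] := eqVneq m 0; first by rewrite subr0 distrC ltxx.
have := @norm_intr_ge1 R m%:~R (intr_int _ m); rewrite intr_eq0 => /(_ m0) m1.
have := lerB_dist m%:~R (u - t); rewrite (distrC m%:~R) (distrC u t).
by move=> ? ?; lra.
Qed.

(** Two parameters whose images are close are either close themselves or near opposite ends of
    [[0, 1]]. In the second case the path goes through the common point [q (F 1) = q (F 0)], which
    costs [eta] twice. *)
Lemma cover_modulus (F : R -> R) (e eta : R) : e <= 1 ->
  (period q 1 -> q (F 1) = q (F 0)) ->
  (forall t u, 0 <= t <= 1 -> 0 <= u <= 1 -> `|t - u| < e -> `|F t - F u| <= eta) ->
  forall t u, 0 <= t <= 1 -> 0 <= u <= 1 -> mdist (q t) (q u) < e ->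
    mdist (q (F t)) (q (F u)) <= eta + eta.
Proof.
move=> e1 F01 Fe t u t01 u01 tue.
have dF t' u' : 0 <= t' <= 1 -> 0 <= u' <= 1 -> `|t' - u'| < e ->
    mdist (q (F t')) (q (F u')) <= eta.
  by move=> *; rewrite (le_trans (cover_lip hq _ _))// Fe.
have wrap t' u' : 0 <= t' <= 1 -> 0 <= u' <= 1 -> period q 1 -> `|u' - t' - 1| < e ->
    mdist (q (F t')) (q (F u')) <= eta + eta.
  move=> t01' u01' q1; rewrite ltr_norml => /andP[h1 h2].
  have [/andP[? ?] /andP[? ?]] := (t01', u01').
  rewrite (le_trans (metric_triangle _ (q (F 0)) _))// lerD//.
    by apply: dF => //; rewrite ?lexx ?ler01// subr0 ger0_norm//; lra.
  rewrite -F01//; apply: dF => //; rewrite ?lexx ?ler01// ger0_norm//; lra.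
have eta0 : 0 <= eta.
  apply: le_trans (Fe t t t01 t01 _) => //.
  by rewrite subrr normr0 (le_lt_trans _ tue)// mdist_ge0.
have [m qm] := cover_lift hq t01 u01 tue.
have [/andP[? ?] /andP[? ?]] := (t01, u01).
(* The cases are 0, 1, at least 2, -1, at most -2. Since [|u - t| <= 1] and [e <= 1], a translation
   by 2 or more is impossible. *)
case: m qm => [[|[|k]]|[|k]] qm.
- rewrite subr0 distrC => tu; rewrite (le_trans (dF _ _ t01 u01 tu))//.
  by rewrite lerDl.
- by move=> tu; apply: wrap.
- rewrite ltr_norml => /andP[h1 _].
  by exfalso; move: h1; rewrite -pmulrn -addn2 natrD; have := ler0n R k; lra.
- have q1 : period q 1 by have := periodN qm.
  rewrite NegzE intrN /= => tu; rewrite metric_sym; apply: wrap => //.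
  by rewrite -normrN; move: tu; congr (`| _ | < _); lra.
- rewrite NegzE intrN -pmulrn ltr_norml => /andP[_ h2].
  by exfalso; move: h2; rewrite -addn2 natrD; have := ler0n R k; lra.
Qed.

Lemma cover_section : exists s : X -> R,
  (forall a, 0 <= s a <= 1) /\ (forall a, q (s a) = a).
Proof.
have /choice[s sP] : forall a : X, exists t : R, 0 <= t <= 1 /\ q t = a.
  by move=> a; have [t] := cover_surj hq a; exists t.
by exists s; split=> a; have [] := sP a.
Qed.

(** The map is [q \o F \o s] for a section [s], which need not be continuous. The modulus of
    [cover_modulus] gives both continuity and independence of the choice of parameter. *)
Lemma cover_descent (F : R -> R) : continuous F ->
  (period q 1 -> q (F 1) = q (F 0)) ->
  exists psi : C0 X, forall t, 0 <= t <= 1 -> psi (q t) = q (F t).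
Proof.
move=> cF F01; have [s [s01 qs]] := cover_section.
have modulus eta : 0 < eta -> exists2 e, 0 < e & forall t u,
    0 <= t <= 1 -> 0 <= u <= 1 -> mdist (q t) (q u) < e ->
    mdist (q (F t)) (q (F u)) < eta.
  move=> eta0; have eta30 : 0 < eta / 3 by rewrite divr_gt0.
  have [d d0 dP] := compact_unif_continuous (@segment_compact _ 0 1)
    (fun x _ => cF x) eta30.
  exists (Num.min d 1) => [|t u t01 u01 tu]; first by rewrite lt_min d0 ltr01.
  apply: (@le_lt_trans _ _ (eta / 3 + eta / 3)); last by lra.
  apply: (cover_modulus (e := Num.min d 1)) => //; first by rewrite ge_min lexx orbT.
  move=> t' u' t01' u01' tu'.
  have := dP t' u'; rewrite /= in_itv/= => /(_ t01').
  rewrite -ball_normE/= => H; apply/ltW/H.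
  by move: tu'; rewrite lt_min => /andP[].
have wd t u : 0 <= t <= 1 -> 0 <= u <= 1 -> q t = q u -> q (F t) = q (F u).
  move=> t01 u01 tu; apply: (@mdist_positivity R); apply/eqP.
  rewrite eq_le mdist_ge0 andbT; apply/ler_addgt0Pr => eta eta0; rewrite add0r.
  have [e e0 eP] := modulus _ eta0.
  by apply/ltW/eP => //; rewrite tu mdistxx.
have cpsi : continuous (fun a : X => q (F (s a))).
  move=> a; apply/metricType_numDomainType.cvgrPdist_lt => eta eta0.
  have [e e0 eP] := modulus _ eta0.
  apply/metricType_numDomainType.nbhs_mdistP; exists e => //= b ab.
  by apply: eP => //; rewrite !qs.
by exists (mkcts cpsi) => t t01; apply: wd => //; rewrite ?qs.
Qed.

End line_cover.

(** * Piecewise maps of the line built from a profile and node values *)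

Section wave.
Context {R : realType}.
Implicit Types (x y : R) (w : R -> R) (c : nat -> R) (N n i : nat).

Definition clip01 x : R := Num.max 0 (Num.min x 1).

Lemma clip01_itv x : 0 <= clip01 x <= 1.
Proof. by rewrite /clip01 le_max lexx ge_max ler01 ge_min lexx orbT. Qed.

Lemma clip01_id x : 0 <= x <= 1 -> clip01 x = x.
Proof. by move=> /andP[x0 x1]; rewrite /clip01 min_l// max_r. Qed.

Lemma clip01_eq0 x : x <= 0 -> clip01 x = 0.
Proof. by move=> x0; rewrite /clip01 min_l ?max_l//; lra. Qed.

Lemma clip01_eq1 x : 1 <= x -> clip01 x = 1.
Proof. by move=> x1; rewrite /clip01 min_r// max_r. Qed.

Lemma clip01_lip x y : `|clip01 x - clip01 y| <= `|x - y|.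
Proof.
wlog xy : x y / x <= y.
  by move=> H; have [/H//|/ltW/H] := leP x y; rewrite distrC (distrC y).
have cl t : [\/ t <= 0 /\ clip01 t = 0, 0 <= t <= 1 /\ clip01 t = t
    | 1 <= t /\ clip01 t = 1].
  have [t0|t0] := leP t 0; first by constructor 1; rewrite clip01_eq0.
  have [t1|/ltW t1] := leP t 1; last by constructor 3; rewrite clip01_eq1.
  by constructor 2; rewrite clip01_id ?(ltW t0).
rewrite [leRHS]distrC [leRHS]ger0_norm ?subr_ge0// ler_norml.
by case: (cl x) => -[] => [?|/andP[? ?]|?] ->; case: (cl y) => -[] => [?|/andP[? ?]|?] ->;
  apply/andP; split; lra.
Qed.

Lemma clip01_continuous : continuous clip01.
Proof.
move=> x; apply/cvgrPdist_lt => e e0.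
near=> y; apply: le_lt_trans (clip01_lip x y) _.
by near: y; exact: cvgr_dist_lt.
Unshelve. all: by end_near. Qed.

(** On the left half of the [i]-th cell the position is half of the argument of [w]. Halving the
    value of [w] as well sends left halves to left halves, so that [w] itself is iterated. *)
Definition wave_term N c w i x : R :=
  w (2 * (N%:R * x - i%:R)) / 2 +
  (c i.+1 - c i) * clip01 (2 * (N%:R * x - i%:R) - 1).

(* With [y] the position of [x] in the [i]-th of the [N] equal subintervals of
   [0, 1], [N * wave x] is a copy of [w] at height [c i] while [y <= 1/2], and
   then moves affinely from [c i] to [c i.+1]. *)
Definition wave N c w x : R := (c 0%N + \sum_(i < N) wave_term N c w i x) / N%:R.

(** On the [i]-th cell the ramps of all earlier terms are complete and telescope to [c i], while all
    later terms still vanish. *)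
Lemma waveE N c w i x : (i < N)%N ->
  (forall t, t <= 0 \/ 1 <= t -> w t = 0) -> i%:R <= N%:R * x <= i.+1%:R ->
  wave N c w x = (c i + wave_term N c w i x) / N%:R.
Proof.
move=> iN w0; rewrite -natr1 => /andP[x1 x2]; congr (_ / _).
have lo n : (n <= i)%N -> c 0%N + \sum_(j < n) wave_term N c w j x = c n.
  elim: n => [_|n IH ni]; first by rewrite big_ord0 addr0.
  rewrite big_ord_recr/= addrA (IH (ltnW ni)) /wave_term.
  have h : n%:R + 1 <= N%:R * x by rewrite natr1 (le_trans _ x1)// ler_nat.
  rewrite w0; last by right; lra.
  by rewrite clip01_eq1; [ring|lra].
have hi n : (i < n)%N -> c 0%N + \sum_(j < n) wave_term N c w j x =
    c i + wave_term N c w i x.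
  elim: n => // n IH; rewrite ltnS leq_eqVlt => /predU1P[<-|ni].
    by rewrite big_ord_recr/= addrA lo.
  rewrite big_ord_recr/= addrA IH// [wave_term N c w n x]/wave_term.
  have h : N%:R * x <= n%:R by rewrite (le_trans x2)// natr1 ler_nat.
  rewrite w0; last by left; lra.
  by rewrite clip01_eq0; [ring|lra].
exact: hi.
Qed.

Lemma wave_continuous N c w : continuous w -> continuous (wave N c w).
Proof.
move=> cw x; apply: cvgM; last exact: cvg_cst.
apply: cvgD; first exact: cvg_cst.
apply: cvg_big => [|i _].
  exact: add_continuous.
have cl : {for x, continuous (fun x => 2 * (N%:R * x - i%:R))}.
  apply: cvgM; first exact: cvg_cst.
  by apply: cvgB; [exact: mulrl_continuous|exact: cvg_cst].
apply: cvgD.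
  apply: cvgM; last exact: cvg_cst.
  exact: (@continuous_comp _ _ _ (fun x => 2 * (N%:R * x - i%:R)) w x cl (cw _)).
apply: cvgM; first exact: cvg_cst.
apply: (@continuous_comp _ _ _ (fun x => 2 * (N%:R * x - i%:R) - 1) clip01).
  by apply: cvgB; [exact: cl|exact: cvg_cst].
exact: clip01_continuous.
Qed.

Lemma wave_lip N c : (0 < N)%N -> exists2 L : R, 0 <= L &
  forall x y, `|wave N c (cst 0) x - wave N c (cst 0) y| <= L * `|x - y|.
Proof.
move=> N0; have N0R : (0 : R) < N%:R by rewrite ltr0n.
exists (\sum_(i < N) `|c i.+1 - c i| * 2) => [|x y].
  by rewrite sumr_ge0// => i _; rewrite mulr_ge0.
rewrite /wave -mulrBl opprD addrACA subrr add0r -sumrB normrM normfV (gtr0_norm N0R) ler_pdivrMr//.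
rewrite (le_trans (ler_norm_sum _ _ _))// !mulr_suml ler_sum// => i _.
rewrite /wave_term /= !mul0r !add0r -mulrBr normrM -!mulrA ler_wpM2l//.
apply: le_trans (clip01_lip _ _) _.
rewrite [X in `|X|](_ : _ = 2 * ((x - y) * N%:R)); last by ring.
by rewrite !normrM (gtr0_norm N0R) ger0_norm.
Qed.

End wave.

(** * Approximation by wave maps, and density of dimension zero *)

Section perturbation.
Context (R : realType) (X : compactMetricType R) (q : R -> X) (hq : line_cover q).
Implicit Types (phi psi : C0 X).

Lemma unif_dist_le phi psi (M : R) : 0 <= M ->
  (forall a, mdist (phi a) (psi a) <= M) -> mdist phi psi <= M.
Proof.
move=> M0 H; rewrite [leLHS]/(unif_dist phi psi) /unif_dist.
have [->|/set0P ne] := eqVneq (range (fun x : X => mdist (phi x) (psi x))) set0.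
  by rewrite sup0.
by apply: ge_sup => // _ [x _ <-].
Qed.

(* [c] lifts the rounded values [z i / N] of [phi] at the points [i / N] to the
   line (both scaled by [N]), with small increments. *)
Record nodes phi (delta : R) (N : nat) (c : nat -> R) (z : nat -> nat) : Prop := Nodes {
  nodes_gt0 : (0 < N)%N ;
  nodes_mesh : N%:R^-1 < delta ;
  nodes_lift : forall i x, q ((c i + x) / N%:R) = q (((z i)%:R + x) / N%:R) ;
  nodes_lt : forall i, (z i < N)%N ;
  nodes_step : forall i, `|c i.+1 - c i| / N%:R <= 3 * delta ;
  nodes_close : forall i, mdist (phi (q (i%:R / N%:R))) (q ((z i)%:R / N%:R)) < delta ;
  nodes_per : period q 1 -> z N = z 0%N ;
  nodes_osc : forall i x, `|i%:R / N%:R - x| <= N%:R^-1 ->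
    mdist (phi (q (i%:R / N%:R))) (phi (q x)) < delta }.

(** Consecutive rounded values are less than [3 * delta] apart in [X]: two rounding errors and one
    oscillation of [phi]. Each step can thus be lifted to a short one after translation by a period
    [m i]; summing these periods gives a lift along the whole grid. *)
Lemma nodes_ex phi (delta : R) : 0 < delta -> exists N c z, nodes phi delta N c z.
Proof.
move=> delta0; have [s [s01 qs]] := cover_section hq.
have [d d0 dP] := compact_unif_continuous (@compact_setT R X)
  (fun x _ => @cts_fun _ _ phi x) delta0.
have phid a b : mdist a b < d -> mdist (phi a) (phi b) < delta.
  by have := dP a b I; rewrite !ballEmdist.
pose N := (Num.truncn (Num.min d delta)^-1).+1.
have m0 : 0 < Num.min d delta by rewrite lt_min d0.
have N0 : (0 : R) < N%:R by rewrite ltr0n.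
have Nm : N%:R^-1 < Num.min d delta.
  by rewrite -[ltRHS]invrK ltf_pV2 ?posrE ?invr_gt0//; exact: truncnS_gt.
have [Nd Ndelta] : N%:R^-1 < d /\ N%:R^-1 < delta.
  by move: Nm; rewrite lt_min => /andP.
have Ni (i : nat) : i.+1%:R / N%:R - i%:R / N%:R = N%:R^-1 :> R.
  by rewrite -mulrBl -natr1 addrAC subrr add0r mul1r.
pose v i := s (phi (q (i%:R / N%:R))).
(* The minimum matters when [v i = 1]: truncation gives [N], which is not the index of a cell. The
   error is still at most [1 / N]. *)
pose z i := minn (Num.truncn (N%:R * v i)) N.-1.
have zlt i : (z i < N)%N by rewrite /z /N /= ltnS geq_minr.
have zle1 i : 0 <= ((z i)%:R / N%:R : R) <= 1.
  apply/andP; split; first by rewrite divr_ge0.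
  by rewrite ler_pdivrMr// mul1r ler_nat ltnW.
have zv i : `|v i - (z i)%:R / N%:R| <= N%:R^-1.
  have /andP[v0 v1] : 0 <= v i <= 1 by exact: s01.
  have /andP[t1 t2] : (Num.truncn (N%:R * v i))%:R <= N%:R * v i
      < (Num.truncn (N%:R * v i)).+1%:R by rewrite truncn_itv// mulr_ge0.
  have -> : v i - (z i)%:R / N%:R = (N%:R * v i - (z i)%:R) / N%:R.
    by field; rewrite gt_eqF.
  rewrite normrM normfV (gtr0_norm N0) ler_piMl ?invr_ge0//.
  have vN : N%:R * v i <= N%:R by rewrite ler_piMr.
  rewrite /z; case: (leqP (Num.truncn (N%:R * v i)) N.-1) => h.
    by rewrite -natr1 in t2; rewrite ger0_norm; lra.
  have : N%:R <= (Num.truncn (N%:R * v i))%:R :> R by rewrite ler_nat.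
  have : N.-1%:R + 1 = N%:R :> R by rewrite natr1.
  by move=> *; rewrite ger0_norm; lra.
have close i : mdist (phi (q (i%:R / N%:R))) (q ((z i)%:R / N%:R)) <= N%:R^-1.
  by rewrite -[X in mdist X]qs (le_trans (cover_lip hq _ _))//; exact: zv.
have osc i x : `|i%:R / N%:R - x| <= N%:R^-1 ->
    mdist (phi (q (i%:R / N%:R))) (phi (q x)) < delta.
  move=> ix; apply: phid; apply: le_lt_trans (cover_lip hq _ _) _.
  exact: le_lt_trans ix Nd.
have /choice[m mP] : forall i, exists m, period q m /\
    `|(z i.+1)%:R / N%:R - (z i)%:R / N%:R - m%:~R| < 3 * delta.
  move=> i; have [|m] := cover_lift hq (e := 3 * delta) (zle1 i) (zle1 i.+1);
    last by exists m.
  apply: le_lt_trans (metric_triangle _ (phi (q (i%:R / N%:R))) _) _.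
  rewrite metric_sym (le_lt_trans (lerD (lexx _) (metric_triangle _ (phi (q (i.+1%:R / N%:R))) _)))//.
  have := close i; have := close i.+1.
  have := osc i (i.+1%:R / N%:R); rewrite distrC Ni ger0_norm ?invr_ge0//.
  by move=> /(_ (lexx _)) *; lra.
pose M n := \sum_(i < n) m i.
have qM n : period q (M n) by apply: period_sum => i; have [] := mP i.
(* With the accumulated periods subtracted, [(c i.+1 - c i) / N] is the short lifted step chosen
   with [m i]. *)
exists N, (fun i => (z i)%:R - N%:R * (M i)%:~R), z; split => //.
- move=> i x; rewrite -[RHS](periodN (qM i)); congr q; rewrite intrN.
  by field; rewrite gt_eqF.
- move=> i; apply/ltW; have [_] := mP i.
  rewrite /M big_ord_recr/= intrD -[X in `|_| / X](gtr0_norm N0) -normfV -normrM.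
  congr (`|_| < _); field; by rewrite gt_eqF.
- by move=> i; exact: le_lt_trans (close i) _.
- move=> q1; rewrite /z /v divff ?gt_eqF// mul0r.
  by have := q1 0; rewrite add0r => ->.
Qed.

(** The bound [6 * delta] adds up one oscillation of [phi], one rounding error, and [4 * delta] for
    the wave within a cell: less than [delta] for the copy of [w], of height at most [1 / N], and
    [3 * delta] for the ramp. *)
Lemma wave_perturbation phi (delta : R) N c z (w : R -> R) :
  nodes phi delta N c z -> continuous w ->
  (forall t, t <= 0 \/ 1 <= t -> w t = 0) -> (forall t, 0 <= w t <= 1) ->
  exists psi, mdist phi psi <= 6 * delta /\
    (forall t, 0 <= t <= 1 -> psi (q t) = q (wave N c w t)).
Proof.
move=> nd cw w0 w01; have N0 : (0 : R) < N%:R by rewrite ltr0n (nodes_gt0 nd).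
have delta0 : 0 < delta by apply: lt_trans (nodes_mesh nd); rewrite invr_gt0.
have [psi psiE] : exists psi : C0 X, forall t, 0 <= t <= 1 -> psi (q t) = q (wave N c w t).
  apply: cover_descent => //; first exact: wave_continuous.
  move=> q1.
  (* The summand 0 puts both end values in the form to which [nodes_lift] applies; they then agree
     by [nodes_per]. *)
  have -> : wave N c w 1 = (c N + 0) / N%:R.
    have Npred : N.-1.+1 = N by rewrite prednK// (nodes_gt0 nd).
    rewrite (@waveE _ _ _ _ N.-1)//; last 2 first.
    - by rewrite Npred.
    - by rewrite Npred mulr1 lexx ler_nat leq_pred.
    have e : N%:R * 1 - N.-1%:R = 1 :> R.
      by rewrite mulr1 -{1}Npred -natr1 addrAC subrr add0r.
    rewrite /wave_term e Npred w0; last by right; lra.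
    by rewrite clip01_eq1; [congr (_ / _); ring|lra].
  have -> : wave N c w 0 = (c 0%N + 0) / N%:R.
    rewrite (@waveE _ _ _ _ 0%N)//; last 2 first.
    - exact: nodes_gt0 nd.
    - by rewrite mulr0 lexx ler0n.
    rewrite /wave_term mulr0 subrr mulr0 w0; last by left.
    by rewrite clip01_eq0; [congr (_ / _); ring|lra].
  by rewrite !(nodes_lift nd) (nodes_per nd q1).
exists psi; split => //; apply: unif_dist_le => [|a]; first by rewrite mulr_ge0// ltW.
have [t t01 <-] := cover_surj hq a; rewrite psiE//.
have /andP[t0 t1] := t01.
have [i [iN /andP[i1 i2]]] : exists i, (i < N)%N /\ i%:R <= N%:R * t <= i.+1%:R.
  have [tl|tl] := ltP t 1.
    have /andP[h1 h2] : (Num.truncn (N%:R * t))%:R <= N%:R * t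
      < (Num.truncn (N%:R * t)).+1%:R by rewrite truncn_itv// mulr_ge0.
    exists (Num.truncn (N%:R * t)); split; last by rewrite h1 ltW.
    by rewrite -(ltr_nat R) (le_lt_trans h1)// gtr_pMr.
  have -> : t = 1 by lra.
  exists N.-1; rewrite prednK ?(nodes_gt0 nd)//; split => //.
  by rewrite mulr1 lexx ler_nat leq_pred.
have Nmesh := nodes_mesh nd.
have osc : mdist (phi (q (i%:R / N%:R))) (phi (q t)) < delta.
  apply: (nodes_osc nd); rewrite -[t in `|_ - t|](mulKf (lt0r_neq0 N0)) mulrC -mulrBr.
  rewrite normrM normfV (gtr0_norm N0) ler_piMr ?invr_ge0//.
  by have i2' := i2; rewrite -natr1 in i2'; rewrite distrC ger0_norm; lra.
have cl := nodes_close nd i.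
have wv : mdist (q ((z i)%:R / N%:R)) (q (wave N c w t)) <= 4 * delta.
  rewrite (@waveE _ _ _ _ i)//; last by rewrite i1 i2.
  rewrite -[(z i)%:R]addr0 -(nodes_lift nd).
  apply: le_trans (cover_lip hq _ _) _.
  rewrite -mulrBl addr0 opprD addNKr normrM normrN normfV (gtr0_norm N0).
  rewrite /wave_term; set y := 2 * _.
  have /andP[? ?] := w01 y; have /andP[k0 k1] := clip01_itv (y - 1).
  have st := nodes_step nd i.
  apply: (@le_trans _ _ ((1 + `|c i.+1 - c i|) / N%:R)).
    rewrite ler_pM2r ?invr_gt0// (le_trans (ler_normD _ _))// lerD//.
      by rewrite ger0_norm; lra.
    by rewrite normrM (ger0_norm k0) ler_piMr.
  by rewrite mulrDl mul1r; lra.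
have := metric_triangle (phi (q t)) (phi (q (i%:R / N%:R))) (q (wave N c w t)).
have := metric_triangle (phi (q (i%:R / N%:R))) (q ((z i)%:R / N%:R)) (q (wave N c w t)).
by rewrite (metric_sym (phi (q t)) (phi _)) => *; lra.
Qed.

Lemma dense_upper_mdim_le0 phi (delta : R) : 0 < delta ->
  exists2 psi, mdist phi psi < delta & (upper_mdim psi <= 0)%E.
Proof.
move=> delta0; have d70 : 0 < delta / 7 by rewrite divr_gt0.
have [N [c [z nd]]] := nodes_ex phi d70.
have [|||psi [phipsi psiE]] := wave_perturbation (w := cst 0) nd.
- by move=> x; exact: cst_continuous.
- by [].
- by move=> t /=; rewrite lexx ler01.
exists psi; first by lra.
have [L L0 FL] := @wave_lip _ N c (nodes_gt0 nd).
have [s [s01 qs]] := cover_section hq.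
(* For [2 * d <= 1], [cover_modulus] at the scale [2 * d] gives [2 * (L * (2 * d))]; the scale is
   not [d] because the modulus asks for a strict inequality. For larger [d] the trivial bound [L] is
   below [2 * L * d]. The summand 1 makes the constant at least 1. *)
apply: (@lipschitz_upper_mdim _ _ psi (1 + 4 * L) s) => //.
- by lra.
- by move=> a b; rewrite -{1}(qs a) -{1}(qs b); exact: cover_lip.
move=> a b; set d := mdist a b.
have [ab|ab] := eqVneq a b; first by rewrite ab /d ab !mdistxx mulr0.
have d0 : 0 < d by rewrite mdist_gt0.
have Ld0 : 0 <= L * d by rewrite mulr_ge0// ltW.
have [d1|d1] := leP (2 * d) 1.
  apply: (@le_trans _ _ (L * (2 * d) + L * (2 * d))); last by lra.
  rewrite -(qs a) -(qs b) !psiE//.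
  apply: (@cover_modulus _ _ _ hq (wave N c (cst 0)) (2 * d)) => //.
  - move=> q1; rewrite -!psiE ?lexx ?ler01//.
    by have := q1 0; rewrite add0r => ->.
  - by move=> t u _ _ tu; apply: le_trans (FL _ _) _; rewrite ler_wpM2l// ltW.
  - by rewrite !qs -/d; lra.
rewrite -{1}(qs a) -{1}(qs b) !psiE// (le_trans (cover_lip hq _ _))//.
apply: le_trans (FL _ _) _.
have sab : `|s a - s b| <= 1.
  by have := s01 a; have := s01 b; rewrite ler_norml => /andP[? ?] /andP[? ?]; lra.
have := ler_wpM2l L0 sab; have : L * 1 <= L * (2 * d) by rewrite ler_wpM2l// ltW.
by lra.
Qed.

End perturbation.

(** * Density of maps with dimension close to one *)

Section wild_density.
Context (R : realType) (X : compactMetricType R).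

(** For [eps] between [C / B ^ (k + 1)] and [C / B ^ k], the quotient is at least [k p ln 2] over
    [(k + 1) (p + 1) ln 2 - ln C]. This tends to [p / (p + 1)], which exceeds [c]. *)
Lemma lower_mdim_ge (phi : C0 X) (p : nat) (C c : R) : 0 < C -> 0 <= c ->
  c * p.+1%:R < p%:R ->
  (forall k eps, 0 < eps < C / (2 ^+ p.+1) ^+ k ->
    ((k%:R * p%:R * ln 2)%:E <= sep_rate phi eps)%E) ->
  (c%:E <= lower_mdim phi)%E.
Proof.
move=> C0 c0 cp H.
have l2 : (0 : R) < ln 2 by rewrite ln_gt0// ltr1n.
pose B : R := 2 ^+ p.+1.
have B1 : 1 <= B by rewrite exprn_ege1// ler1n.
have B0 : 0 < B by exact: lt_le_trans B1.
(* The inequality [b <= k * a] is a rearrangement of [c * ((k + 1) (p + 1) ln 2 - ln C) <= k p ln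
   2]. *)
pose a := (p%:R - c * p.+1%:R) * ln 2.
have a0 : 0 < a by rewrite mulr_gt0// subr_gt0.
pose b := c * (p.+1%:R * ln 2 - ln C).
pose k0 := (Num.truncn (b / a)).+1.
have k0P k : (k0 <= k)%N -> b <= k%:R * a.
  move=> kk; rewrite -ler_pdivrMr// (@le_trans _ _ k0%:R) ?ler_nat//.
  by apply/ltW; exact: truncnS_gt.
pose e0 := Num.min (C / B ^+ k0) 1.
have e00 : 0 < e0 by rewrite lt_min ltr01 divr_gt0 ?exprn_gt0.
apply: (limf_einf_ge (V := [set x | 0 < x < e0])).
  by near=> x; rewrite /=; apply/andP; split=> //; near: x; exact: nbhs_right_lt.
move=> eps /= /andP[eps0]; rewrite lt_min => /andP[epsk0 eps1].
have ex : exists j, C / B ^+ j.+1 <= eps.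
  pose n := Num.truncn (C / eps); exists n.
  rewrite ler_pdivrMr ?exprn_gt0// mulrC -ler_pdivrMr//.
  apply: le_trans (ltW (truncnS_gt _)) _.
  apply: (@le_trans _ _ (2 ^+ n.+1)); first by rewrite -natrX ler_nat ltnW// ltn_expl.
  rewrite lerXn2r ?nnegrE ?(ltW B0)// /B exprS ler_peMr//.
  by rewrite exprn_ege1// ler1n.
have decr i j : (i <= j)%N -> C / B ^+ j <= C / B ^+ i.
  by move=> ij; rewrite ler_pM2l// lef_pV2 ?posrE ?exprn_gt0// ler_weXn2l.
(* The least such index is the scale of [eps]: by minimality [eps < C / B ^ k], and [eps < e0]
   forces [k >= k0]. *)
case: (ex_minnP ex) => k kP kmin.
have k0k : (k0 <= k)%N.
  rewrite leqNgt; apply/negP => kk0.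
  by have := le_lt_trans (le_trans (decr _ _ kk0) kP) epsk0; rewrite ltxx.
have epsk : eps < C / B ^+ k.
  have k_gt0 : (0 < k)%N by exact: leq_trans k0k.
  rewrite ltNge; apply/negP; rewrite -(prednK k_gt0) => /kmin.
  by rewrite leqNgt ltn_predL k_gt0.
have lneps : ln eps < 0 by rewrite ln_lt0// eps0.
have nl : 0 < `|ln eps| by rewrite normr_gt0 lt_eqF.
have lneps2 : - ln eps <= k.+1%:R * (p.+1%:R * ln 2) - ln C.
  have : ln (C / B ^+ k.+1) <= ln eps by rewrite ler_ln ?posrE// divr_gt0 ?exprn_gt0.
  rewrite ln_div ?posrE ?exprn_gt0// lnXn// /B lnXn//.
  by rewrite -(mulr_natl (ln 2)) -(mulr_natl (_ * ln 2)); lra.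
apply: (@le_trans _ _ ((k%:R * p%:R * ln 2)%:E * (`|ln eps|^-1)%:E)%E); last first.
  by rewrite lee_pmul2r ?lte_fin ?invr_gt0//; apply: H; rewrite eps0.
rewrite -EFinM lee_fin ler_pdivlMr// ltr0_norm//.
apply: le_trans (ler_wpM2l c0 lneps2) _.
have kab : 0 <= k%:R * a - b by rewrite subr_ge0 k0P.
rewrite -subr_ge0; move: kab; rewrite /a /b -[k.+1%:R]natr1.
by congr (_ <= _); ring.
Unshelve. all: by end_near. Qed.

Context (q : R -> X) (hq : line_cover q).
Implicit Types phi psi : C0 X.

Lemma dense_lower_mdim_ge phi (c delta : R) : 0 <= c < 1 -> 0 < delta ->
  exists2 psi, mdist phi psi < delta & (c%:E <= lower_mdim psi)%E.
Proof.
move=> /andP[c0 c1] delta0; have d70 : 0 < delta / 7 by rewrite divr_gt0.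
(* The condition on [p] amounts to [c / (1 - c) < p]. *)
have [p p0 cp] : exists2 p : nat, (0 < p)%N & c * p.+1%:R < p%:R.
  exists (Num.truncn (c / (1 - c))).+1 => //.
  have := truncnS_gt (c / (1 - c)); move: _.+1 => p.
  by rewrite ltr_pdivrMr ?subr_gt0// -natr1; lra.
have [N [z0 [z nd]]] := nodes_ex hq phi d70.
have [||psi [phipsi psiE]] := wave_perturbation hq (w := wild p) nd (@continuous_wild _ p).
- exact: wild_out.
- by move=> t; rewrite wild_ge0 wild_le1.
exists psi; first by lra.
have N0 : (0 : R) < N%:R by rewrite ltr0n (nodes_gt0 nd).
have cell (i : nat) (t : R) : (i < N)%N -> 0 <= t <= 1 ->
    0 <= (i%:R + t / 2) / N%:R <= 1.
  move=> iN /andP[t0 t1].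
  have : i.+1%:R <= N%:R :> R by rewrite ler_nat.
  rewrite -natr1 divr_ge0 ?ler_pdivrMr//=; last by rewrite addr_ge0// divr_ge0.
  by move=> *; lra.
have step (i : nat) (t : R) : (i < N)%N -> 0 <= t <= 1 ->
    psi (q ((i%:R + t / 2) / N%:R)) = q (((z i)%:R + wild p t / 2) / N%:R).
  move=> iN t01; have /andP[t0 t1] := t01; rewrite psiE ?cell//.
  have e : N%:R * ((i%:R + t / 2) / N%:R) = i%:R + t / 2.
    by rewrite mulrC divfK ?gt_eqF.
  rewrite (@waveE _ _ _ _ i)//; last 2 first.
  - exact: wild_out.
  - by rewrite e -[i.+1%:R]natr1; apply/andP; split; lra.
  rewrite (nodes_lift nd) /wave_term e; congr (q (_ / _)); congr (_ + _).
  rewrite addrAC subrr add0r (mulrC 2) divfK// clip01_eq0; last by lra.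
  by rewrite mulr0 addr0.
(* The left half of cell [i] goes to the left half of cell [z i], so an orbit starting in cell 0
   visits the cells [idx j] while its position inside them evolves under [wild p]. *)
pose idx j := iter j z 0%N.
have idxN j : (idx j < N)%N.
  by case: j => [|j]; [exact: nodes_gt0 nd|exact: nodes_lt nd _].
have wild_iter01 j (t : R) : 0 <= t <= 1 -> 0 <= iter j (wild p) t <= 1.
  by case: j => //= j _; rewrite wild_ge0 wild_le1.
have orbit j t : 0 <= t <= 1 ->
    iter j psi (q ((t / 2) / N%:R)) =
    q (((idx j)%:R + iter j (wild p) t / 2) / N%:R).
  move=> t01; elim: j => [|j IH]; first by rewrite /= add0r.
  by rewrite iterS IH step//; exact: wild_iter01.
(* Chosen so that [C / (2 ^ (p + 1)) ^ k] is [gap p (2 ^ k)] divided by [2 * N], the factor by which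
   the copy of [wild p] in a cell is scaled down. *)
pose C : R := (2 * p%:R * (2 * N%:R))^-1 / 2 ^+ p.+1.
have C0 : 0 < C.
  by rewrite divr_gt0 ?exprn_gt0// invr_gt0 !mulr_gt0// ltr0n.
apply: (@lower_mdim_ge psi p C) => // k eps /andP[eps0 epsk].
have [->|k0] := posnP k; last first.
  pose s := (2 ^ (k * p))%N.
  have U2 : 2 <= 2 ^+ k :> R.
    by rewrite -{1}(expr1 2) ler_weXn2l// ler1n.
  have sU : s%:R = (2 ^+ k : R) ^+ p by rewrite natrX exprM.
  have -> : k%:R * p%:R * ln 2 = ln (s%:R : R).
    by rewrite natrX lnXn// -(mulr_natl (ln 2)) natrM.
  apply: sep_rate_ge => [|n]; first by rewrite expn_gt0.
  have [T [T01 TP]] := @wild_separated R p s n _ p0 U2 sU.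
  have -> : (s ^ n)%N = #|{: {ffun 'I_n -> 'I_s}}| by rewrite card_ffun !card_ord.
  apply: (sep_ge_card (g := fun v => q ((T v / 2) / N%:R)) (ltW eps0)) => v v' vv'.
  have [j jn gj] := TP v v' vv'; exists j => //; rewrite !orbit//.
  have y01 := wild_iter01 j _ (T01 v); have x01 := wild_iter01 j _ (T01 v').
  set y := iter j _ (T v) in gj y01 *; set x := iter j _ (T v') in gj x01 *.
  have dE : `|((idx j)%:R + y / 2) / N%:R - ((idx j)%:R + x / 2) / N%:R| =
      `|y - x| / (2 * N%:R).
    rewrite [X in `|X|](_ : _ = (y - x) / (2 * N%:R)); last by field; rewrite gt_eqF.
    by rewrite normrM normfV [X in _ / X]gtr0_norm// mulr_gt0.
  (* Both points lie in the left half of one cell, hence within 1/2 of each other, and distances on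
     the line bound those in [X] from below. *)
  apply: lt_le_trans (cover_isometry hq _ _ _); rewrite ?cell// dE; last first.
    have N1 : 1 <= N%:R :> R by rewrite ler1n (nodes_gt0 nd).
    rewrite ler_pdivrMr ?mulr_gt0//; apply: (@le_trans _ _ 1); last by lra.
    by move: x01 y01 => /andP[? ?] /andP[? ?]; rewrite ler_norml; lra.
  rewrite ltr_pdivlMr ?mulr_gt0//; apply: lt_le_trans gj.
  rewrite -ltr_pdivlMr ?mulr_gt0//; apply: lt_le_trans epsk _.
  rewrite /gap /C exprMn -!exprM (mulnC p.+1) le_eqVlt; apply/orP; left; apply/eqP.
  have pow0 m : (2 : R) ^+ m != 0 by rewrite expf_neq0// pnatr_eq0.
  have pR0 : (p%:R : R) != 0 by rewrite pnatr_eq0 -lt0n.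
  move: (pow0 p.+1) (pow0 (k * p.+1)%N) (lt0r_neq0 N0) pR0.
  move: (_ ^+ _) (_ ^+ _) => A B A0 B0 NR0 pR0; field.
  by rewrite NR0 pR0 A0 B0.
(* For [k = 0] the condition [2 <= U] fails with [U = 2 ^ k], but the claim is only that the rate is
   nonnegative, and a single point shows it. *)
rewrite !mul0r.
have := @sep_rate_ge _ _ psi eps 1%N isT; rewrite ln1; apply => n.
rewrite exp1n.
have := @sep_ge_card _ _ n psi eps unit (fun=> q 0) (ltW eps0).
by rewrite card_unit; apply => -[] [].
Qed.

End wild_density.

(** * From density to the failure of semi-continuity *)

Section semicontinuity_failure.
Context (R : realType) (X : compactMetricType R) (q : R -> X) (hq : line_cover q).
Context (mdim : C0 X -> \bar R).
Context (hmdim : mdim = @lower_mdim R X \/ mdim = @upper_mdim R X).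

Lemma dnbhs_mdist (phi : C0 X) (V : set (C0 X)) : phi^' V ->
  exists2 d : R, 0 < d & forall psi, mdist phi psi < d -> psi != phi -> V psi.
Proof.
rewrite /dnbhs /within /= => /metricType_numDomainType.nbhs_mdistP[d /= d0 dV].
by exists d => // psi psid; exact: dV.
Qed.

Lemma dense_mdim_le0 (phi : C0 X) (d : R) : 0 < d ->
  exists2 psi, mdist phi psi < d & (mdim psi <= 0)%E.
Proof.
move=> /(dense_upper_mdim_le0 hq phi)[psi psid psi0]; exists psi => //.
by case: hmdim => -> //; apply: le_trans (lower_le_upper_mdim psi) psi0.
Qed.

Lemma dense_mdim_ge (phi : C0 X) (c d : R) : 0 <= c < 1 -> 0 < d ->
  exists2 psi, mdist phi psi < d & (c%:E <= mdim psi)%E.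
Proof.
move=> c01 /(dense_lower_mdim_ge hq phi c01)[psi psid psic]; exists psi => //.
by case: hmdim => -> //; apply: le_trans psic (lower_le_upper_mdim psi).
Qed.

(** Maps with dimension at most 0 come arbitrarily close to [phi]. They differ from [phi] because
    their dimension does, hence lie in the punctured neighbourhoods. *)
Lemma not_lower_semicontinuous_at (phi : C0 X) : (0 < mdim phi)%E ->
  ~ lower_semicontinuous_at mdim phi.
Proof.
move=> phi0 /(lt_le_trans phi0); apply/negP; rewrite -leNgt.
apply: limf_einf_le => V /dnbhs_mdist[d d0 dV].
have [psi psid psi0] := dense_mdim_le0 phi d0; exists psi => //.
by apply: dV => //; apply: contraTneq psi0 => ->; rewrite -ltNge.
Qed.

Lemma not_upper_semicontinuous_at (phi : C0 X) : (mdim phi < 1)%E ->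
  ~ upper_semicontinuous_at mdim phi.
Proof.
move=> phi1.
have [c [c01 phic]] : exists c : R, 0 <= c < 1 /\ (mdim phi < c%:E)%E.
  (* A number strictly between [mdim phi] and 1 is needed, kept nonnegative for [dense_mdim_ge]; the
     value [-oo] is dealt with formally by 0. *)
  case: (mdim phi) phi1 => [r||]//; last by exists 0; rewrite lexx ltr01 ltNyr.
  rewrite lte_fin => r1; exists (Num.max 0 ((r + 1) / 2)).
  rewrite le_max lexx gt_max ltr01 lte_fin lt_max.
  by split; [lra|apply/orP; right; lra].
move=> /le_lt_trans/(_ phic); apply/negP; rewrite -leNgt.
apply: limf_esup_ge => V /dnbhs_mdist[d d0 dV].
have [psi psid psic] := dense_mdim_ge phi c01 d0; exists psi => //.
by apply: dV => //; apply: contraTneq psic => ->; rewrite -ltNge.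
Qed.

Lemma mdim_not_semicontinuous :
  [/\ ~ (forall phi : C0 X, lower_semicontinuous_at mdim phi),
      ~ (forall phi : C0 X, upper_semicontinuous_at mdim phi),
      forall phi, (0 < mdim phi)%E -> (mdim phi <= 1)%E ->
        ~ lower_semicontinuous_at mdim phi
    & forall phi, (0 <= mdim phi)%E -> (mdim phi < 1)%E ->
        ~ upper_semicontinuous_at mdim phi].
Proof.
(* Any map would do: density around it provides one map with dimension at least 1/2 and one with
   dimension at most 0, at which the local statements apply. *)
have phi : C0 X := idfun.
split=> [H|H|psi psi0 _|psi _].
- have [||psi _ psi1] := @dense_mdim_ge phi 2^-1 1 => //.
    by apply/andP; split; lra.
  apply: not_lower_semicontinuous_at (H psi).
  by apply: lt_le_trans psi1; rewrite lte_fin.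
- have [psi _ psi0] := @dense_mdim_le0 phi 1 ltr01.
  by apply: not_upper_semicontinuous_at (H psi); apply: le_lt_trans psi0 _.
- exact: not_lower_semicontinuous_at.
- exact: not_upper_semicontinuous_at.
Qed.

End semicontinuity_failure.

(** * The interval and the circle as covered spaces *)

Lemma unit_interval_cover (R : realType) :
  exists q : R -> unit_interval R, line_cover q.
Proof.
have h0 : (0 : R) \in (`[0, 1]%classic : set R).
  by rewrite inE /= in_itv /= lexx ler01.
pose q (x : R) : unit_interval R := insubd (exist _ 0 h0 : unit_interval R) (clip01 x).
have qE x : set_val (q x) = clip01 x.
  by rewrite /q set_valE insubdK// inE /= in_itv/= clip01_itv.
have dE x y : mdist (q x) (q y) = `|clip01 x - clip01 y| by rewrite -!qE.
exists q; split.
- by move=> x y; rewrite dE; exact: clip01_lip.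
- move=> a; have a01 : 0 <= set_val a <= 1.
    by have := set_valP a; rewrite /= in_itv.
  by exists (set_val a) => //; apply: val_inj; rewrite -set_valE qE clip01_id.
- move=> t u e t01 u01; rewrite dE !clip01_id// => tue; exists 0.
    exact: period0.
  by rewrite subr0 distrC.
Qed.

Lemma circle_cover (R : realType) : line_cover (\pi_(circle R)%qT : R -> circle R).
Proof.
split.
- move=> x y; apply: ge_inf; last by exists (x, y).
  by exists 0 => _ [p _ <-]; exact: normr_ge0.
- move=> a; exists (repr a - (Num.floor (repr a))%:~R).
    have := floor_itv (repr a); rewrite intrD => /andP[h1 h2].
    by apply/andP; split; lra.
  rewrite -[RHS]reprK; apply/circle_piP.
  by rewrite addrAC subrr sub0r rpredN intr_int.
move=> t u e _ _ tue.
have [|_ [[x y] /= [/circle_piP xt /circle_piP yu] <-] xye] := inf_lt _ tue.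
  by exists `|t - u|, (t, u).
move: xt yu => /intrP[m xt] /intrP[n yu].
(* With [x = t + m] and [y = u + n], the number [u - t - (m - n)] is [y - x], whose absolute value
   is less than [e]. *)
exists (m - n).
  by move=> z; apply/circle_piP; rewrite addrAC subrr add0r; exact: intr_int.
rewrite intrB -xt -yu; move: xye; rewrite distrC; congr (`| _ | < _); lra.
Qed.

Local Open Scope ereal_scope.

Theorem proposition5p1 (R : realType) (X : compactMetricType R)
    (hX : X = unit_interval R :> compactMetricType R \/
          X = circle R :> compactMetricType R)
    (mdim : C0 X -> \bar R)
    (hmdim : mdim = @lower_mdim R X \/ mdim = @upper_mdim R X) :
  [/\ ~ (forall phi : C0 X, lower_semicontinuous_at mdim phi),
      ~ (forall phi : C0 X, upper_semicontinuous_at mdim phi),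
      forall phi, 0 < mdim phi -> mdim phi <= 1 ->
        ~ lower_semicontinuous_at mdim phi
    & forall phi, 0 <= mdim phi -> mdim phi < 1 ->
        ~ upper_semicontinuous_at mdim phi].
Proof.
suff [q hq] : exists q : R -> X, line_cover q.
  exact (mdim_not_semicontinuous hq hmdim).
case: hX => ->; first exact: unit_interval_cover.
by exists \pi_(circle R)%qT; exact: circle_cover.
Qed.
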